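(* The Lipschitz Clustering Property is not invariant under quasisymmetric maps: there exist metric spaces $X$ and $Y$ and a quasisymmetric homeomorphism $f$ of $X$ onto $Y$ such that $X$ has the Lipschitz Clustering Property and $Y$ does not.
   Context: A homeomorphism $f$ of $X$ onto $Y$ is quasisymmetric if there exists a homeomorphism $\eta\colon[0,\infty)\to[0,\infty)$ such that for any three distinct points $x,u,v$ in $X$ we have $\frac{d_Y(f(x),f(u))}{d_Y(f(x),f(v))}\le\eta\left(\frac{d_X(x,u)}{d_X(x,v)}\right)$. For a metric space $(X,d)$ and a positive integer $n$, $X(n)=\{A\subset X\colon 1\le |A|\le n\}$, equipped with the Hausdorff metric $\Delta(A,B)=\max\left(\sup_{a\in A}\operatorname{dist}(a,B),\ \sup_{b\in B}\operatorname{dist}(b,A)\right)$; $X(n-1)\subset X(n)$. $X$ has the Lipschitz Clustering Property (LCP) if for every integer $n\ge 2$ there exists a Lipschitz map $X(n)\to X(n-1)$ whose restriction to $X(n-1)$ is the identity (a Lipschitz retraction). *)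

(* Defs.v *)
From mathcomp Require Import all_boot all_order all_algebra.
From mathcomp Require Import all_classical all_reals all_analysis.
Set Implicit Arguments.
Unset Strict Implicit.
Unset Printing Implicit Defensive.
Import Order.TTheory GRing.Theory Num.Theory.
Import numFieldNormedType.Exports.
Local Open Scope classical_set_scope.
Local Open Scope ring_scope.

Definition homeomorphism_on (T U : topologicalType) (A : set T) (B : set U)
    (f : T -> U) : Prop :=
  exists g : U -> T,
    [/\ set_fun A B f, set_fun B A g,
        {in A, cancel f g} /\ {in B, cancel g f},
        {within A, continuous f} & {within B, continuous g}].

Definition quasisymmetric (R : realType) (X Y : metricType R) (f : X -> Y) :
    Prop :=
  homeomorphism_on [set: X] [set: Y] f /\
  exists eta : R -> R,
    homeomorphism_on (`[0, +oo[ : set R) (`[0, +oo[ : set R) eta /\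
    forall x u v : X, x <> u -> x <> v -> u <> v ->
      mdist (f x) (f u) / mdist (f x) (f v) <= eta (mdist x u / mdist x v).

(* The space X(n); its points are the nonempty subsets of X with at most n
   elements. *)
Definition finite_subset_space (X : Type) (n : nat) : set (set X) :=
  [set A | A !=set0 /\ (A #<= `I_n)%card].
Arguments finite_subset_space X n : clear implicits.

Definition dist_to_set (R : realType) (X : metricType R) (x : X) (B : set X) :
    R :=
  inf [set mdist x b | b in B].

(* Meaningful for nonempty bounded sets only, which covers X(n): elsewhere the
   real-valued sup and inf may take their default value 0. *)
Definition hausdorff_dist (R : realType) (X : metricType R) (A B : set X) : R :=
  Num.max (sup [set dist_to_set a B | a in A])
          (sup [set dist_to_set b A | b in B]).

(* A map X(n) -> X(m) is represented by a total function on subsets of X,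
   whose values outside X(n) are irrelevant. *)
Definition lipschitz_retraction (R : realType) (X : metricType R) (n m : nat)
    (r : set X -> set X) : Prop :=
  [/\ set_fun (finite_subset_space X n) (finite_subset_space X m) r,
      exists L : R, forall A B : set X,
        finite_subset_space X n A -> finite_subset_space X n B ->
        hausdorff_dist (r A) (r B) <= L * hausdorff_dist A B
    & forall A : set X, finite_subset_space X m A -> r A = A].

Definition LCP (R : realType) (X : metricType R) : Prop :=
  forall n : nat, (2 <= n)%N ->
    exists r : set X -> set X, lipschitz_retraction n n.-1 r.

(* Main.v *)
Require Import Defs.
From HB Require Import structures.
From mathcomp Require Import all_boot all_order all_algebra.
From mathcomp Require Import all_classical all_reals all_analysis.
From mathcomp Require Import finmap ring lra.

(* Take two copies F and T of the real line at distance 1 from each other, each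
   with the distance min(1, |x - y|); Y is obtained from X by replacing the
   distance of T by its square root. The identity X -> Y is quasisymmetric with
   eta t = t + sqrt t.

   X has the Lipschitz Clustering Property: if A has n points and d is the least
   gap between two points of A on the same line, subtracting d from every gap
   merges two points, and depends on A in a Lipschitz way as long as A moves by
   less than its separation. When it moves more, one only uses that every point
   is displaced by at most n times the separation.

   Y has no Lipschitz retraction r of Y(4) onto Y(3): let A consist of F 0, F t
   and of T 0, T b with b small. As t goes from 0 to 1, A moves along a Lipschitz
   curve. T contains no nonconstant Lipschitz curve, so the points of r(A) on T
   remain T 0 and T b. At t = 1, r(A) must also have a point near each of F 0 and
   F 1, because A is close to {F 0, F 1, T 0}; this makes four points. The
   constancy is quantitative: if [0, 1] is cut into N steps, each step moves a
   point of T by at most K / N, hence its coordinate by at most (K / N)^2. *)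

Set Implicit Arguments.
Unset Strict Implicit.
Unset Printing Implicit Defensive.
Import Order.TTheory GRing.Theory Num.Theory.
Import numFieldNormedType.Exports.
Local Open Scope classical_set_scope.
Local Open Scope ring_scope.

(** * Finite subsets and duplicate-free lists *)

Lemma finite_subset_space_seq (X : choiceType) n (A : set X) :
  finite_subset_space X n A ->
  exists s : seq X, [/\ A = [set` s], uniq s, (0 < size s)%N & (size s <= n)%N].
Proof.
case=> -[x Ax] An.
have fA : finite_set A by apply/finite_set_leP; exists n.
exists (fset_set A); split.
- by apply/seteqP; split=> y; rewrite /= in_fset_set//; [move/mem_set|move/set_mem].
- exact: fset_uniq.
- have : x \in fset_set A by rewrite in_fset_set//; apply/mem_set.
  by rewrite -[_ \in _]/(_ \in finmap.enum_fset _); case: (finmap.enum_fset _).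
- exact: geq_card_fset_set.
Qed.

Lemma seq_finite_subset_space (X : choiceType) n (s : seq X) :
  (0 < size s)%N -> (size s <= n)%N -> finite_subset_space X n [set` s].
Proof.
case: s => // x s _ sn; split; first by exists x; rewrite /= mem_head.
have -> : [set` x :: s] = nth x (x :: s) @` `I_(size (x :: s)).
  apply/seteqP; split=> [y /= /(nthP x)[i i_lt <-]|_ [i /= i_lt <-]].
    by exists i.
  exact: mem_nth.
by apply: card_le_trans (card_image_le _ _) _; rewrite card_le_II.
Qed.

Lemma finite_subset_space_size (X : choiceType) n (A : set X) (s : seq X) :
  finite_subset_space X n A -> uniq s -> (forall x, x \in s -> A x) ->
  (size s <= n)%N.
Proof.
move=> /finite_subset_space_seq[t [-> _ _ tn]] us st.
exact: leq_trans (uniq_leq_size us st) tn.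
Qed.

(** Ensures that the infima and suprema in the Hausdorff distance are attained; a maximum is a
    minimum of the opposite function. *)
Lemma finite_subset_space_min (R : realType) (Y : choiceType) n
    (A : set Y) (f : Y -> R) :
  finite_subset_space Y n A ->
  exists2 b, A b & forall c, A c -> f b <= f c.
Proof.
move=> /finite_subset_space_seq[s [-> _ s0 _]].
elim: s s0 => // x s IH _; case: s IH => [_|y s /(_ isT)[b bs bmin]].
  by exists x; rewrite /= ?mem_head// => c; rewrite inE => /eqP->.
have [bx|xb] := leP (f b) (f x).
  exists b; first by rewrite /= inE [b \in _]bs orbT.
  by move=> c /=; rewrite inE => /predU1P[->//|]; apply: bmin.
exists x; first by rewrite /= mem_head.
by move=> c /=; rewrite inE => /predU1P[->//|/bmin]; exact: le_trans (ltW xb).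
Qed.

(** * Hausdorff distance between finite sets *)

Section Hausdorff.
Variables (R : realType) (X : metricType R).
Implicit Types (A B C : set X) (e : R).

(** One half of a Hausdorff bound, free of [sup] and [inf]. *)
Definition near_subset e A B := forall a, A a -> exists2 b, B b & mdist a b <= e.

Lemma dist_to_set_le n x B e : finite_subset_space X n B ->
  (dist_to_set x B <= e) <-> (exists2 b, B b & mdist x b <= e).
Proof.
move=> Bn.
have lbB : has_lbound [set mdist x b | b in B].
  by exists 0 => _ [c _ <-]; apply: mdist_ge0.
split=> [le_e|[b Bb xb]]; last first.
  by apply: le_trans xb; apply: ge_inf => //; exists b.
have [b Bb bmin] := finite_subset_space_min (mdist x) Bn.
exists b => //; apply: le_trans le_e; apply: lb_le_inf.
  by exists (mdist x b), b.
by move=> _ [c Bc <-]; apply: bmin.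
Qed.

Lemma sup_dist_to_set_le n A B e :
  finite_subset_space X n A -> finite_subset_space X n B ->
  (sup [set dist_to_set a B | a in A] <= e) <-> near_subset e A B.
Proof.
move=> An Bn; split=> [le_e a Aa|AB].
  apply/(dist_to_set_le _ _ Bn); apply: le_trans le_e.
  apply: ub_le_sup; last by exists a.
  have [b _ bmax] := finite_subset_space_min (fun a => - dist_to_set a B) An.
  by exists (dist_to_set b B) => _ [c Ac <-]; rewrite -lerN2 bmax.
apply: ge_sup; first by case: An => -[a Aa] _; exists (dist_to_set a B), a.
by move=> _ [a Aa <-]; apply/(dist_to_set_le _ _ Bn)/AB.
Qed.

Lemma hausdorff_dist_le n A B e :
  finite_subset_space X n A -> finite_subset_space X n B ->
  (hausdorff_dist A B <= e) <-> near_subset e A B /\ near_subset e B A.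
Proof.
move=> An Bn; rewrite /hausdorff_dist ge_max.
split=> [/andP[]|[]] /(sup_dist_to_set_le _ An Bn) AB
  /(sup_dist_to_set_le _ Bn An) BA; first by [].
by rewrite AB BA.
Qed.

Lemma hausdorff_dist_ge0 n A B :
  finite_subset_space X n A -> finite_subset_space X n B ->
  0 <= hausdorff_dist A B.
Proof.
move=> An Bn; have [/(_ _)AB _] :=
  (hausdorff_dist_le (hausdorff_dist A B) An Bn).1 (lexx _).
have [a /AB[b _]] := An.1; exact: le_trans (mdist_ge0 _ _).
Qed.

Lemma near_subset_trans e1 e2 A B C :
  near_subset e1 A B -> near_subset e2 B C -> near_subset (e1 + e2) A C.
Proof.
move=> AB BC a /AB[b /BC[c Cc bc] ab]; exists c => //.
exact: le_trans (metric_triangle _ _ _) (lerD ab bc).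
Qed.

Lemma near_subsetW e1 e2 A B :
  e1 <= e2 -> near_subset e1 A B -> near_subset e2 A B.
Proof. by move=> e12 AB a /AB[b Bb ab]; exists b => //; apply: le_trans e12. Qed.

Lemma near_subset_refl e A : 0 <= e -> near_subset e A A.
Proof. by move=> e0 a Aa; exists a => //; rewrite mdistxx. Qed.

End Hausdorff.

(* Two lines at distance 1 from each other, each with its metric truncated at
   1; the flag tells whether the metric of the second line is snowflaked. The
   flag is absent from the carrier, so that the identity maps one space onto the
   other. *)
Definition sheets (R : realType) (s : bool) : Type := (bool * R)%type.

(** * The metric on the two sheets *)

Section Sheets.
Variables (R : realType) (s : bool).

Local Notation sheets := (sheets R s).
HB.instance Definition _ := Choice.copy sheets (bool * R)%type.

Definition sheet_dist (p q : sheets) : R :=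
  if p.1 == q.1 then
    let m := Num.min 1 `|p.2 - q.2| in if s && p.1 then Num.sqrt m else m
  else 1.

Lemma min1_ge0 (x y : R) : 0 <= Num.min 1 `|x - y|.
Proof. by rewrite le_min ler01 normr_ge0. Qed.

Lemma sheet_dist_ge0 p q : 0 <= sheet_dist p q.
Proof.
rewrite /sheet_dist; case: eqP => //= _.
by case: ifP => _; rewrite ?sqrtr_ge0// min1_ge0.
Qed.

Lemma sheet_dist_le1 p q : sheet_dist p q <= 1.
Proof.
rewrite /sheet_dist; case: eqP => //= _.
have m1 : Num.min 1 `|p.2 - q.2| <= 1 by rewrite ge_min lexx.
by case: ifP => _ //; rewrite -[leRHS]sqrtr1 ler_wsqrtr.
Qed.

Lemma sheet_distxx p : sheet_dist p p = 0.
Proof.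
by rewrite /sheet_dist eqxx subrr normr0 /= min_r// sqrtr0 if_same.
Qed.

Lemma sheet_dist_eq0 p q : sheet_dist p q = 0 -> p = q.
Proof.
rewrite /sheet_dist; case: p q => [i x] [j y] /=; case: eqP => [->|_]; last first.
  by move=> /eqP; rewrite oner_eq0.
set m := Num.min _ _ => d0.
have m0 : m <= 0.
  by move: d0; case: ifP => _ [/eqP]; rewrite ?sqrtr_eq0// => /eqP->.
congr pair; apply/eqP; rewrite -subr_eq0 -normr_le0.
by move: m0; rewrite /m ge_min ler10.
Qed.

Lemma sheet_distC p q : sheet_dist p q = sheet_dist q p.
Proof.
by rewrite /sheet_dist eq_sym distrC; case: eqP => // ->.
Qed.

Lemma sqrtrD_le (x y : R) : 0 <= x -> 0 <= y ->
  Num.sqrt (x + y) <= Num.sqrt x + Num.sqrt y.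
Proof.
move=> x0 y0; rewrite -ler_sqr ?nnegrE ?addr_ge0 ?sqrtr_ge0//.
by rewrite sqrrD !sqr_sqrtr ?addr_ge0// addrAC lerDl mulrn_wge0.
Qed.

(** A step that changes sheet has length 1, which already bounds the left side; otherwise truncation
    and square root are both subadditive. *)
Lemma sheet_dist_triangle q p r :
  sheet_dist p r <= sheet_dist p q + sheet_dist q r.
Proof.
have [pq|npq] := eqVneq p.1 q.1; last first.
  rewrite {2}/sheet_dist (negPf npq).
  by rewrite (le_trans (sheet_dist_le1 _ _))// lerDl sheet_dist_ge0.
have [qr|nqr] := eqVneq q.1 r.1; last first.
  rewrite {3}/sheet_dist (negPf nqr).
  by rewrite (le_trans (sheet_dist_le1 _ _))// lerDr sheet_dist_ge0.
rewrite /sheet_dist pq qr eqxx /=.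
have mD : Num.min 1 `|p.2 - r.2| <=
    Num.min 1 `|p.2 - q.2| + Num.min 1 `|q.2 - r.2|.
  have := ler_distD q.2 p.2 r.2; rewrite ge_min.
  have := normr_ge0 (p.2 - q.2); have := normr_ge0 (q.2 - r.2).
  by case: (leP 1 `|p.2 - q.2|); case: (leP 1 `|q.2 - r.2|); lra.
case: ifP => _ //; apply: le_trans (ler_wsqrtr mD) _.
exact: sqrtrD_le (min1_ge0 _ _) (min1_ge0 _ _).
Qed.

HB.instance Definition _ := @isMetric.Build R sheets sheet_dist
  sheet_distxx sheet_dist_eq0 sheet_distC sheet_dist_triangle.

Lemma mdist_sheetsE (p q : sheets) : mdist p q = sheet_dist p q.
Proof. by []. Qed.

End Sheets.

(** * Quasisymmetry of the identity *)

Lemma metric_continuous (R : realType) (X Y : metricType R) (f : X -> Y) :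
  (forall p e, 0 < e ->
    exists2 d, 0 < d & forall q, mdist p q < d -> mdist (f p) (f q) < e) ->
  continuous f.
Proof.
move=> H p; apply/cvg_ballP => e e0; have [d d0 Hd] := H p e e0.
near=> q; rewrite ballEmdist; apply: Hd; near: q.
by apply: filterS (nbhsx_ballx p d d0) => q; rewrite ballEmdist.
Unshelve. all: by end_near. Qed.

Section Snowflake.
Variable R : realType.

(** Across sheets this still holds, as the distance 1 is its own square root. *)
Lemma snowflake_distE (p q : bool * R) :
  mdist (p : sheets R true) q =
  if p.1 then Num.sqrt (mdist (p : sheets R false) q)
  else mdist (p : sheets R false) q.
Proof.
rewrite !mdist_sheetsE /sheet_dist /=; case: eqP => // _.
by rewrite sqrtr1 if_same.
Qed.

Lemma snowflake_dist_ge (p q : bool * R) :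
  mdist (p : sheets R false) q <= mdist (p : sheets R true) q.
Proof.
rewrite snowflake_distE; case: ifP => // _.
have d0 := mdist_ge0 (p : sheets R false) q.
have d1 : mdist (p : sheets R false) q <= 1 := sheet_dist_le1 _ _.
rewrite -{1}(sqr_sqrtr d0) expr2 ler_piMl ?sqrtr_ge0//.
by rewrite -[leRHS]sqrtr1 ler_wsqrtr.
Qed.

Lemma snowflake_dist_lt (p q : bool * R) e : 0 < e ->
  mdist (p : sheets R false) q < Num.min e (e ^+ 2) ->
  mdist (p : sheets R true) q < e.
Proof.
rewrite snowflake_distE lt_min => e0 /andP[d_e d_ee].
case: ifP => // _.
by rewrite -(ger0_norm (ltW e0)) -sqrtr_sqr ltr_sqrt// exprn_gt0.
Qed.

Let id_XY : sheets R false -> sheets R true := id.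
Let id_YX : sheets R true -> sheets R false := id.

Lemma continuous_id_XY : continuous id_XY.
Proof.
apply: metric_continuous => p e e0; exists (Num.min e (e ^+ 2)).
  by rewrite lt_min e0 exprn_gt0.
by move=> q; apply: snowflake_dist_lt.
Qed.

Lemma continuous_id_YX : continuous id_YX.
Proof.
apply: metric_continuous => p e e0; exists e => // q.
exact: le_lt_trans (snowflake_dist_ge _ _).
Qed.

Let eta (t : R) := t + Num.sqrt t.
(** For [y >= 0], the square of the nonnegative root [s] of [s ^+ 2 + s = y]. *)
Let eta_inv (y : R) := ((Num.sqrt (1 + 4 * y) - 1) / 2) ^+ 2.

Lemma homeomorphism_add_sqrt :
  homeomorphism_on (`[0, +oo[ : set R) (`[0, +oo[ : set R) eta.
Proof.
exists eta_inv; split.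
- by move=> t; rewrite /= !in_itv /= !andbT => t0; rewrite addr_ge0 ?sqrtr_ge0.
- by move=> y; rewrite /= !in_itv /= !andbT => y0; rewrite exprn_even_ge0.
- split=> x /set_mem; rewrite /= in_itv /= andbT => x0.
    have s0 := sqrtr_ge0 x; rewrite /eta_inv /eta -{1}(sqr_sqrtr x0).
    set s := Num.sqrt x in s0 *.
    have -> : 1 + 4 * (s ^+ 2 + s) = (2 * s + 1) ^+ 2 by ring.
    rewrite sqrtr_sqr ger0_norm; last lra.
    by rewrite addrK mulrC mulKf// sqr_sqrtr.
  rewrite /eta /eta_inv.
  have r1 : 1 <= Num.sqrt (1 + 4 * x) by rewrite -[leLHS]sqrtr1 ler_wsqrtr; lra.
  have : Num.sqrt (1 + 4 * x) ^+ 2 = 1 + 4 * x by rewrite sqr_sqrtr; lra.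
  set r := Num.sqrt _ in r1 * => rE.
  rewrite sqrtr_sqr ger0_norm; last lra.
  by rewrite expr_div_n; field: rE; lra.
- apply: continuous_subspaceT => t; apply: cvgD; first exact: cvg_id.
  exact: sqrt_continuous.
- apply: continuous_subspaceT => y; rewrite /eta_inv.
  have h : (fun y : R => (Num.sqrt (1 + 4 * y) - 1) / 2) x @[x --> y] -->
      (Num.sqrt (1 + 4 * y) - 1) / 2.
    apply: cvgMl; apply: cvgB; last exact: cvg_cst.
    apply: continuous_comp; last exact: sqrt_continuous.
    by apply: cvgD; [exact: cvg_cst|apply: cvgMr; exact: cvg_id].
  exact: (cvgM h h).
Qed.

Lemma quasisymmetric_snowflake : quasisymmetric id_XY.
Proof.
split.
  exists id_YX; split=> //; apply: continuous_subspaceT.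
    exact: continuous_id_XY.
  exact: continuous_id_YX.
exists eta; split; first exact: homeomorphism_add_sqrt.
move=> x u v _ _ _; rewrite !snowflake_distE /eta.
have du := mdist_ge0 x u; have dv := mdist_ge0 x v.
(* Both distances start at [x], so its sheet decides for both: the ratio is kept or replaced by its
   square root. *)
case: ifP => _; last by rewrite lerDl sqrtr_ge0.
by rewrite -sqrtrV// -sqrtrM// lerDr divr_ge0.
Qed.

End Snowflake.

(** * Failure of the clustering property on the snowflaked space *)

(** Below distance 1 there is no change of sheet and no truncation; undoing the square root gives
    the quadratic bound behind the small drift. *)
Lemma sheet_dist_near (R : realType) s (p q : sheets R s) e : e < 1 ->
  mdist p q <= e -> p.1 = q.1 /\ `|p.2 - q.2| <= if s && p.1 then e ^+ 2 else e.
Proof.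
move=> e1; rewrite mdist_sheetsE /sheet_dist.
have [pq|_ /(lt_le_trans e1)] := eqVneq p.1 q.1; last by rewrite ltxx.
move=> /= d_e; split=> //; move: d_e; case: ifP => _ d_e; last first.
  by move: d_e; rewrite ge_min leNgt e1.
have m0 := min1_ge0 p.2 q.2; have s0 := sqrtr_ge0 (Num.min 1 `|p.2 - q.2|).
have : Num.min 1 `|p.2 - q.2| <= e ^+ 2.
  by rewrite -[leLHS](sqr_sqrtr m0) ler_pXn2r// nnegrE (le_trans s0).
by rewrite ge_min leNgt expr_lt1// ?e1// (le_trans s0).
Qed.

Lemma not_LCP_snowflake (R : realType) : ~ LCP (sheets R true).
Proof.
move=> /(_ 4 isT)[r [r_fun [L rL] r_id]].
pose F x : sheets R true := (false, x); pose T x : sheets R true := (true, x).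
pose K := Num.max L 1.
have K1 : 1 <= K by rewrite le_max lexx orbT.
have rK A B e : finite_subset_space _ 4 A -> finite_subset_space _ 4 B ->
    near_subset e A B -> near_subset e B A -> near_subset (K * e) (r A) (r B).
  move=> A4 B4 AB BA; have h_e := (hausdorff_dist_le e A4 B4).2 (conj AB BA).
  suff /(hausdorff_dist_le _ (r_fun _ A4) (r_fun _ B4))[] :
    hausdorff_dist (r A) (r B) <= K * e by [].
  have h0 := hausdorff_dist_ge0 A4 B4.
  apply: le_trans (rL A B A4 B4) _; apply: (@le_trans _ _ (K * hausdorff_dist A B)).
    by rewrite ler_wpM2r// le_max lexx.
  by rewrite ler_wpM2l// (le_trans ler01).
(* A displacement by [s] becomes at most [K * s = 1/4], so the images near [F 0] and near [F 1] stay
   distinct. *)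
pose s := (4 * K)^-1.
have K0 : 0 < K by apply: lt_le_trans K1.
have s0 : 0 < s by rewrite invr_gt0 mulr_gt0.
have Ks : K * s = 4^-1 by rewrite /s; field; apply: lt0r_neq0.
have s1 : s < 1.
  by apply: le_lt_trans (_ : K * s < 1); [rewrite ler_peMl// ltW|rewrite Ks; lra].
(* This makes the total drift of [N] steps, [K ^+ 2 / N], less than a quarter of the gap [s ^+ 2]
   between the two points on [T]. *)
have [N N0 KN] : exists2 N, (0 < N)%N & 4 * K ^+ 2 / s ^+ 2 < N%:R.
  pose x := 4 * K ^+ 2 / s ^+ 2; exists (Num.truncn x).+1 => //.
  exact: truncnS_gt.
have N0' : 0 < N%:R :> R by rewrite ltr0n.
have drift : K ^+ 2 / N%:R < s ^+ 2 / 4.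
  by move: KN; rewrite !ltr_pdivrMr ?exprn_gt0//; lra.
(* A step shorter than 1 cannot leave the sheet [T]. *)
have step1 : K / N%:R < 1.
  apply: le_lt_trans (_ : K ^+ 2 / N%:R < 1).
    by rewrite ler_pM2r ?invr_gt0// expr2 ler_peMl// ltW.
  apply: lt_le_trans drift _; rewrite expr2; nra.
pose As k := [:: F 0; F (k%:R / N%:R); T 0; T (s ^+ 2)].
pose A k := [set` As k].
have A4 k : finite_subset_space _ 4 (A k) by apply: seq_finite_subset_space.
have A_step k : near_subset (N%:R^-1) (A k) (A k.+1) /\
    near_subset (N%:R^-1) (A k.+1) (A k).
  have e0 : 0 <= N%:R^-1 :> R by rewrite invr_ge0 ltW.
  have d_e x y : `|x - y| <= N%:R^-1 -> mdist (F x) (F y) <= N%:R^-1.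
    by rewrite mdist_sheetsE /sheet_dist /= ge_min => ->; rewrite orbT.
  have kE : k.+1%:R / N%:R - k%:R / N%:R = N%:R^-1 :> R.
    by rewrite -mulrBl -natrB// subSnn mul1r.
  split=> p; rewrite /A /As /= !inE => /or4P[] /eqP->.
  - by exists (F 0); rewrite ?mdistxx//= !inE eqxx ?orbT.
  - exists (F (k.+1%:R / N%:R)); first by rewrite /= !inE eqxx ?orbT.
    by apply: d_e; rewrite distrC kE ger0_norm.
  - by exists (T 0); rewrite ?mdistxx//= !inE eqxx ?orbT.
  - by exists (T (s ^+ 2)); rewrite ?mdistxx//= !inE eqxx ?orbT.
  - by exists (F 0); rewrite ?mdistxx//= !inE eqxx ?orbT.
  - exists (F (k%:R / N%:R)); first by rewrite /= !inE eqxx ?orbT.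
    by apply: d_e; rewrite kE ger0_norm.
  - by exists (T 0); rewrite ?mdistxx//= !inE eqxx ?orbT.
  - by exists (T (s ^+ 2)); rewrite ?mdistxx//= !inE eqxx ?orbT.
(* At [k = 0] the two points on [F] coincide, so [A 0] lies in X(3) and [r] fixes it. *)
have A0E : A 0 = [set` [:: F 0; T 0; T (s ^+ 2)]].
  by apply/seteqP; split=> p; rewrite /A /As /= mul0r !inE; do ?case: eqP.
have rA_drift c : A 0 (T c) -> forall k,
    exists2 x, r (A k) (T x) & `|c - x| <= k%:R * (K / N%:R) ^+ 2.
  move=> A0c; elim=> [|k [x rAx cx]].
    exists c; last by rewrite subrr normr0 mul0r.
    by rewrite r_id// A0E; apply: seq_finite_subset_space.
  have [Ak Ak'] := A_step k.
  have [q rAq] := rK _ _ _ (A4 k) (A4 k.+1) Ak Ak' _ rAx.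
  case: q rAq => i y rAq /(sheet_dist_near step1)[/= iE xy].
  exists y; first by rewrite /T iE.
  by rewrite (le_trans (ler_distD x _ _))// mulrSr mulrDl mul1r lerD.
pose B := [set` [:: F 0; F 1; T 0]].
have B3 : finite_subset_space _ 3 B by apply: seq_finite_subset_space.
have B4 : finite_subset_space _ 4 B by apply: seq_finite_subset_space.
(* Only [T (s ^+ 2)] is missing from [B], and the square root puts it at distance [s] from [T 0]. *)
have AB : near_subset s (A N) B.
  move=> p; rewrite /A /As /B /= divff ?lt0r_neq0// !inE => /or4P[] /eqP->.
  - by exists (F 0); [rewrite /= !inE eqxx|rewrite mdistxx ltW].
  - by exists (F 1); [rewrite /= !inE eqxx orbT|rewrite mdistxx ltW].
  - by exists (T 0); [rewrite /= !inE eqxx !orbT|rewrite mdistxx ltW].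
  exists (T 0); first by rewrite /= !inE eqxx !orbT.
  rewrite mdist_sheetsE /sheet_dist /= subr0.
  rewrite -[leRHS](ger0_norm (ltW s0)) -[leRHS]sqrtr_sqr ler_wsqrtr//.
  by rewrite ger0_norm ?sqr_ge0// ge_min lexx orbT.
have BA : near_subset s B (A N).
  move=> p Bp; exists p; last by rewrite mdistxx ltW.
  move: Bp; rewrite /B /A /As /= divff ?lt0r_neq0// !inE.
  by case/or3P=> ->; rewrite ?orbT.
have := rK _ _ _ B4 (A4 N) BA AB; rewrite (r_id B B3) Ks => near_B.
have e1 : 4^-1 < 1 :> R by lra.
have [[i1 y1] rq1 /(sheet_dist_near e1)[/= i1E y1_0]] := near_B (F 0) (mem_head _ _).
have [[i2 y2] rq2 /(sheet_dist_near e1)[/= i2E y2_1]] : exists2 q, r (A N) q & mdist (F 1) q <= 4^-1.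
  by apply: near_B; rewrite /B /= !inE eqxx orbT.
have [x1 rx1 x1_0] : exists2 x, r (A N) (T x) & `|0 - x| <= N%:R * (K / N%:R) ^+ 2.
  by apply: rA_drift; rewrite /A /As /= !inE eqxx !orbT.
have [x2 rx2 x2_s] : exists2 x, r (A N) (T x) & `|s ^+ 2 - x| <= N%:R * (K / N%:R) ^+ 2.
  by apply: rA_drift; rewrite /A /As /= !inE eqxx !orbT.
have driftE : N%:R * (K / N%:R) ^+ 2 = K ^+ 2 / N%:R.
  by field; apply: lt0r_neq0.
rewrite driftE in x1_0 x2_s.
have s20 : 0 < s ^+ 2 by rewrite exprn_gt0.
suff : (size [:: (i1, y1) : sheets R true; (i2, y2); T x1; T x2] <= 3)%N by [].
apply: finite_subset_space_size (r_fun _ (A4 N)) _ _.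
  rewrite /T -i1E -i2E /= !inE !xpair_eqE /= !orbF !andbT; apply/andP; split.
    apply/eqP => y12; rewrite y12 in y1_0.
    by move: y1_0 y2_1; rewrite !ler_norml; lra.
  apply/eqP => x12; rewrite x12 in x1_0.
  by move: x1_0 x2_s; rewrite !ler_norml; lra.
by move=> p; rewrite !inE => /or4P[] /eqP->.
Qed.

(** * Shrinking the gaps on the flat sheets *)

Lemma ler_sum_size (R : numDomainType) (I : eqType) (s : seq I) (F : I -> R) e :
  {in s, forall i, F i <= e} -> \sum_(i <- s) F i <= (size s)%:R * e.
Proof.
elim: s => [|i s IH] Fe; first by rewrite big_nil mul0r.
rewrite big_cons /= mulrS mulrDl mul1r lerD ?Fe ?mem_head// IH// => j sj.
by rewrite Fe// inE sj orbT.
Qed.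

Section FlatSheets.
Variable R : realType.
Local Notation X := (sheets R false).
Implicit Types (p q : X) (s t : seq X) (d e x y : R).

Lemma flat_dist_le p q : p.1 = q.1 -> mdist p q <= `|p.2 - q.2|.
Proof.
by move=> pq; rewrite mdist_sheetsE /sheet_dist pq eqxx /= ge_min lexx orbT.
Qed.

Lemma flat_dist_near p q e : e < 1 -> mdist p q <= e ->
  p.1 = q.1 /\ `|p.2 - q.2| <= e.
Proof. exact: sheet_dist_near. Qed.

Lemma flat_dist_le1 p q : mdist p q <= 1.
Proof. exact: sheet_dist_le1. Qed.

Definition clamp d x := Num.max 0 (Num.min x d).

Lemma clamp_ge0 d x : 0 <= clamp d x.
Proof. by rewrite le_max lexx. Qed.

Lemma clamp_le d x : 0 <= d -> clamp d x <= d.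
Proof. by move=> d0; rewrite ge_max d0 ge_min lexx orbT. Qed.

Lemma clamp_dist d d' x x' e :
  `|d - d'| <= e -> `|x - x'| <= e -> `|clamp d x - clamp d' x'| <= e.
Proof.
rewrite /clamp !ler_norml.
by case: (leP x d); case: (leP x' d'); case: (leP 0 x); case: (leP 0 x');
  case: (leP 0 d); case: (leP 0 d'); lra.
Qed.

(* If [d] is the least gap of [s], each summand is [d] when [q] lies below [p]
   and 0 otherwise; written with [clamp], the sum is visibly Lipschitz in the
   points of [s]. *)
Definition push s d p : X :=
  (p.1, p.2 - \sum_(q <- s | q.1 == p.1) clamp d (p.2 - q.2)).

Definition same_sheet s p q := [&& p \in s, q \in s, p.1 == q.1 & p != q].

(** Gaps are differences of coordinates, without truncation, so [d] may exceed 1. *)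
Definition min_gap s d :=
  (exists p q, same_sheet s p q /\ `|p.2 - q.2| = d) /\
  forall p q, same_sheet s p q -> d <= `|p.2 - q.2|.

Lemma min_gap_exists s p q : same_sheet s p q -> exists d, min_gap s d.
Proof.
move=> pq.
pose S := [seq u : X * X <- [seq (a, b) | a <- s, b <- s] | same_sheet s u.1 u.2].
have inS a b : ((a, b) \in S) = same_sheet s a b.
  rewrite mem_filter /=; apply/andb_idr => /and4P[sa sb _ _].
  exact: allpairs_f.
have S0 : (0 < size S)%N by case: S inS => // /(_ p q); rewrite pq.
have [[a b] abS abmin] := finite_subset_space_min
  (fun u : X * X => `|u.1.2 - u.2.2|) (seq_finite_subset_space S0 (leqnn _)).
exists `|a.2 - b.2|; split; first by exists a, b; rewrite -inS.
by move=> u v uv; apply: (abmin (u, v)); rewrite /= inS.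
Qed.

Lemma min_gap_ge0 s d : min_gap s d -> 0 <= d.
Proof. by case=> -[p [q [_ <-]]] _; exact: normr_ge0. Qed.

(** The summand of [p] is 0 for [p] and [d] for [q], which cancels the gap. Any other point of the
    sheet is at least [d] away from [p]: above, it adds 0 to both sums; below, it adds [d] to
    both. *)
Lemma push_eq s d p q : uniq s -> min_gap s d ->
  same_sheet s p q -> q.2 - p.2 = d -> push s d p = push s d q.
Proof.
move=> us sd /and4P[sp sq /eqP pq npq] dE; have d0 := min_gap_ge0 sd.
rewrite /push -pq; congr pair.
rewrite [in LHS]big_mkcond [in RHS]big_mkcond /=.
rewrite (bigD1_seq p sp us) [in RHS](bigD1_seq p sp us) /= eqxx.
have -> : clamp d (p.2 - p.2) = 0 by rewrite subrr /clamp min_l// maxxx.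
have -> : clamp d (q.2 - p.2) = d by rewrite dE /clamp minxx max_r.
set S := bigop _ _ _; set S' := bigop _ _ _; suff -> : S = S' by lra.
rewrite {}/S {}/S' big_seq_cond [RHS]big_seq_cond.
apply: eq_bigr => i /andP[si nip]; case: ifP => // ip.
have : d <= `|i.2 - p.2| by apply: sd.2; rewrite /same_sheet si sp ip.
rewrite ler_normr /clamp => /orP[] h.
  by rewrite !max_l// ge_min; apply/orP; left; lra.
by rewrite !min_r//; lra.
Qed.

Lemma push_near s d p e : 0 <= d -> d <= e ->
  mdist p (push s d p) <= (size s)%:R * e.
Proof.
move=> d0 de; apply: le_trans (flat_dist_le _) _ => //=.
rewrite opprD addNKr opprK ger0_norm; last first.
  by apply: sumr_ge0 => q _; exact: clamp_ge0.
rewrite big_mkcond; apply: ler_sum_size => q _; case: ifP => _; last exact: le_trans de.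
exact: le_trans (clamp_le _ _) de.
Qed.

(** Each of the [size s] summands changes by at most [2 * e], as [clamp] is 1-Lipschitz for the
    maximum of the changes of its two arguments. *)
Lemma push_dist s (f : X -> X) d d' p e : p \in s ->
  {in s, forall q, q.1 = (f q).1 /\ `|q.2 - (f q).2| <= e} ->
  `|d - d'| <= 2 * e ->
  mdist (push s d p) (push (map f s) d' (f p)) <= e + (size s)%:R * (2 * e).
Proof.
move=> sp fs dd'; have [fp1 fp2] := fs p sp.
apply: le_trans (flat_dist_le _) _ => //=.
rewrite big_map -fp1.
have -> : \sum_(q <- s | (f q).1 == p.1) clamp d' ((f p).2 - (f q).2) =
          \sum_(q <- s | q.1 == p.1) clamp d' ((f p).2 - (f q).2).
  rewrite big_seq_cond [RHS]big_seq_cond; apply: eq_bigl => q.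
  by apply: andb_id2l => sq; rewrite -(fs q sq).1.
set S := bigop _ _ _; set S' := bigop _ _ _.
have -> : p.2 - S - ((f p).2 - S') = (p.2 - (f p).2) + (S' - S) by ring.
apply: le_trans (ler_normD _ _) (lerD fp2 _).
rewrite -sumrB; apply: le_trans (ler_norm_sum _ _ _) _.
have e0 : 0 <= 2 * e by apply: le_trans dd'.
rewrite big_mkcond; apply: ler_sum_size => q sq; case: ifP => _ //.
have [_ fq2] := fs q sq; apply: clamp_dist; first by rewrite distrC.
move: fp2 fq2; rewrite !ler_norml; lra.
Qed.

End FlatSheets.

(** * Matching a separated set with a nearby one *)

(** Points more than [2 * e] apart cannot share an [e]-close partner, so [f] is injective; counting
    makes it onto [B]. *)
Lemma near_subset_matching (R : realType) (X : metricType R) n (s : seq X)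
    (B : set X) e :
  uniq s -> size s = n -> finite_subset_space X n B ->
  near_subset e [set` s] B ->
  {in s &, forall p q, p != q -> 2 * e < mdist p q} ->
  exists f : X -> X, [/\ {in s &, injective f},
    B = [set` map f s] & {in s, forall p, mdist p (f p) <= e}].
Proof.
move=> us sn Bn AB far.
have [f fP] : {f : X -> X & forall p, p \in s -> B (f p) /\ mdist p (f p) <= e}.
  apply: (@choice _ _ (fun p q => p \in s -> B q /\ mdist p q <= e)) => p.
  have [sp|nsp] := boolP (p \in s); last by exists p.
  by have [q Bq pq] := AB p sp; exists q.
have f_inj : {in s &, injective f}.
  move=> p q sp sq fpq; apply/eqP; apply: contraT => npq.
  have := far p q sp sq npq; rewrite ltNge => /negP[].
  have [_ dp] := fP p sp; have [_ dq] := fP q sq; rewrite mulrDl mul1r.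
  apply: le_trans (metric_triangle p (f p) q) (lerD dp _).
  by rewrite fpq metric_sym.
exists f; split=> // [|p /fP[]//].
have [t [BE ut _ tn]] := finite_subset_space_seq Bn.
have fst_sub : {subset map f s <= t}.
  by move=> _ /mapP[p /fP[+ _] ->]; rewrite BE.
have ufs : uniq (map f s) by rewrite map_inj_in_uniq.
have [|_ fst_eq] := uniq_min_size ufs fst_sub; first by rewrite size_map sn.
by rewrite BE; apply/seteqP; split=> p /=; rewrite fst_eq.
Qed.

(** * Lipschitz retractions for the flat space *)

Section FlatLCP.
Variable R : realType.
Local Notation X := (sheets R false).
Implicit Types (p q : X) (s t : seq X) (d e x y : R) (A B C : set X).

(* Two points on different sheets cannot be merged by sliding along a sheet; as
   they are at distance 1, the diameter of the space, a constant value does. *)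
Definition merged s C :=
  (exists d, min_gap s d /\ C = [set` map (push s d) s]) \/
  (forall p q, ~~ same_sheet s p q) /\ C = [set` [:: (false, 0)]].

Lemma merged_exists s : exists C, merged s C.
Proof.
have [[p [q /min_gap_exists[d sd]]]|h] := pselect (exists p q, same_sheet s p q).
  by exists [set` map (push s d) s]; left; exists d.
exists [set` [:: (false, 0)]]; right; split=> // p q.
by apply/negP => pq; apply: h; exists p, q.
Qed.

(** Merging depends on the set alone: the list that matching yields for a set may differ from the
    one used to merge it. *)
Lemma merged_perm s t C : perm_eq s t -> merged s C -> merged t C.
Proof.
move=> st.
have ss : same_sheet s =2 same_sheet t.
  by move=> p q; rewrite /same_sheet !(perm_mem st).
have push_st d : push s d =1 push t d.
  by move=> p; rewrite /push (perm_big _ st).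
move=> [[d [sd ->]]|[npq ->]]; [left; exists d|right]; split=> //.
- case: sd => -[p [q [pq pqd]]] dmin; split; first by exists p, q; rewrite -ss.
  by move=> p' q'; rewrite -ss; exact: dmin.
- apply/seteqP; split=> _ /mapP[p sp ->]; apply/mapP; exists p.
  + by rewrite -(perm_mem st).
  + exact: push_st.
  + by rewrite (perm_mem st).
  + by rewrite push_st.
- by move=> p q; rewrite -ss.
Qed.

Lemma merged_subset_space s C : uniq s -> (1 < size s)%N -> merged s C ->
  finite_subset_space X (size s).-1 C.
Proof.
move=> us s1 [[d [sd ->]]|[_ ->]]; last first.
  by apply: seq_finite_subset_space => //=; case: (size s) s1 => [|[]].
have [p [q [pq qpd]]] : exists p q, same_sheet s p q /\ q.2 - p.2 = d.
  have [[p [q [pq pqd]]] _] := sd.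
  have [qp|] := leP q.2 p.2; last first.
    by move=> /ltW qp; exists p, q; split; rewrite // -pqd distrC ger0_norm ?subr_ge0.
  exists q, p; split; last by rewrite -pqd ger0_norm ?subr_ge0.
  by case/and4P: pq => *; apply/and4P; split; rewrite // eq_sym.
have push_pq := push_eq us sd pq qpd.
have /and4P[sp sq _ npq] := pq.
have -> : [set` map (push s d) s] = [set` map (push s d) (rem q s)].
  apply/seteqP; split=> _ /mapP[i si ->]; apply/mapP; last first.
    by exists i => //; apply: mem_rem si.
  have [->|niq] := eqVneq i q; last by exists i; rewrite // mem_rem_uniq// inE niq.
  by exists p; rewrite // mem_rem_uniq// inE npq.
apply: seq_finite_subset_space; rewrite size_map size_rem//.
by case: (size s) s1 => [|[]].
Qed.

Lemma near_subset_map (T : choiceType) (f g : T -> X) (r : seq T) e :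
  {in r, forall i, mdist (f i) (g i) <= e} ->
  near_subset e [set` map f r] [set` map g r] /\
  near_subset e [set` map g r] [set` map f r].
Proof.
move=> fg; split=> _ /mapP[i ri ->]; [exists (g i)|exists (f i)].
- exact: map_f.
- exact: fg.
- exact: map_f.
- by rewrite metric_sym fg.
Qed.

(** If [e >= 1], the diameter bound suffices. Otherwise [p] and [q] share a sheet, the least gap is
    at most [e], and each point slides by at most [size s] times that. *)
Lemma merged_near s C e p q : merged s C -> p \in s -> q \in s -> p != q ->
  mdist p q <= e ->
  near_subset ((size s)%:R * e) [set` s] C /\
  near_subset ((size s)%:R * e) C [set` s].
Proof.
move=> sC sp sq npq pqe; have e0 := le_trans (mdist_ge0 _ _) pqe.
have s0 : (0 < size s)%N by case: (s) sp.
have sE : [set` s] = [set` map id s] by rewrite map_id.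
have [e1|e1] := leP 1 e.
  have e1s : 1 <= (size s)%:R * e.
    by rewrite (le_trans e1)// ler_peMl// ler1n.
  have d_le (i j : X) : mdist i j <= (size s)%:R * e.
    exact: le_trans (flat_dist_le1 _ _) e1s.
  have [c Cc] : C !=set0.
    case: sC => -[]; first by move=> d [_ ->]; exists (push s d p); apply: map_f.
    by move=> _ ->; exists (false, 0); apply: mem_head.
  by split=> i _; [exists c|exists p].
have [pq1 pq2] := flat_dist_near e1 pqe.
have pq : same_sheet s p q by rewrite /same_sheet sp sq pq1 eqxx.
case: sC => [[d [sd ->]]|[/(_ p q)]]; last by rewrite pq.
rewrite sE; apply: near_subset_map => i _.
by apply: push_near; [exact: min_gap_ge0 sd|exact: le_trans (sd.2 _ _ pq) pq2].
Qed.

Lemma merged_close s (f : X -> X) C C' e : 0 <= e ->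
  {in s &, injective f} ->
  {in s, forall p, p.1 = (f p).1 /\ `|p.2 - (f p).2| <= e} ->
  merged s C -> merged (map f s) C' ->
  near_subset (e + (size s)%:R * (2 * e)) C C' /\
  near_subset (e + (size s)%:R * (2 * e)) C' C.
Proof.
move=> e0 f_inj fs.
have ssf p q : same_sheet s p q -> same_sheet (map f s) (f p) (f q).
  case/and4P=> sp sq pq npq; apply/and4P; split; rewrite ?map_f//.
    by rewrite -(fs p sp).1 -(fs q sq).1.
  by apply: contra npq => /eqP/f_inj->.
have ssf' p' q' : same_sheet (map f s) p' q' ->
    exists p q, [/\ same_sheet s p q, p' = f p & q' = f q].
  case/and4P=> /mapP[p sp ->] /mapP[q sq ->] pq npq; exists p, q; split=> //.
  apply/and4P; split=> //; first by rewrite (fs p sp).1 (fs q sq).1.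
  by apply: contra npq => /eqP->.
have pqf p q : same_sheet s p q ->
    `|(`|p.2 - q.2|) - `|(f p).2 - (f q).2| | <= 2 * e.
  case/and4P=> sp sq _ _; have [_ pe] := fs p sp; have [_ qe] := fs q sq.
  apply: le_trans (ler_dist_dist _ _) _.
  by move: pe qe; rewrite !ler_norml; lra.
move=> [[d [sd ->]]|[ns ->]] [[d' [sd' ->]]|[ns' ->]].
- rewrite -map_comp; apply: near_subset_map => p sp; apply: push_dist => //.
  (* Transporting each minimizing pair through [f] bounds the other least gap, whence [d] and [d']
     differ by at most [2 * e]. *)
  have [[p1 [q1 [pq1 d1E]]] dmin] := sd.
  have [[_ [_ [/ssf'[p2 [q2 [pq2 -> ->]]] d2E]]] dmin'] := sd'.
  have := dmin' _ _ (ssf _ _ pq1); have := dmin _ _ pq2.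
  have := pqf _ _ pq1; have := pqf _ _ pq2; rewrite d1E d2E !ler_norml; lra.
- by case: sd => -[p [q [/ssf pq _]]]; rewrite (negPf (ns' _ _)) in pq.
- by case: sd' => -[_ [_ [/ssf'[p [q [pq _ _]]] _]]]; rewrite (negPf (ns _ _)) in pq.
- by split; apply: near_subset_refl; rewrite addr_ge0// !mulr_ge0.
Qed.

(** The graph of the retraction; choice later extracts a function from it. *)
Definition merge_graph n A C :=
  (finite_subset_space X n.-1 A /\ C = A) \/
  exists s, [/\ uniq s, size s = n, A = [set` s] & merged s C].

Definition separated_merge n e A C :=
  exists s, [/\ uniq s, size s = n, A = [set` s], merged s C &
    {in s &, forall p q, p != q -> 2 * e < mdist p q}].

Lemma merge_graph_dichotomy n e A C : 0 <= e -> merge_graph n A C ->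
  (near_subset (n%:R * (2 * e)) A C /\ near_subset (n%:R * (2 * e)) C A) \/
  separated_merge n e A C.
Proof.
move=> e0 [[_ ->]|[s [us sn AE sC]]].
  by left; split; apply: near_subset_refl; rewrite !mulr_ge0.
have [[p [q [sp sq npq pqe]]]|h] := pselect (exists p q,
    [/\ p \in s, q \in s, p != q & mdist p q <= 2 * e]).
  by left; rewrite AE -sn; apply: merged_near pqe.
right; exists s; split=> // p q sp sq npq; rewrite ltNge; apply/negP => pqe.
by apply: h; exists p, q.
Qed.

Lemma separated_merge_close n e A B C C' : (1 < n)%N -> 0 <= e ->
  finite_subset_space X n B -> near_subset e A B ->
  separated_merge n e A C -> merge_graph n B C' ->
  near_subset (e + n%:R * (2 * e)) C C' /\ near_subset (e + n%:R * (2 * e)) C' C.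
Proof.
move=> n1 e0 Bn AB [s [us sn AE sC far]] BC'; rewrite {}AE in AB.
have [f [f_inj BE fe]] := near_subset_matching us sn Bn AB far.
have ufs : uniq (map f s) by rewrite map_inj_in_uniq.
(* Two points more than [2 * e] apart exist, and the diameter is at most 1. Hence matched points lie
   on the same sheet. *)
have e1 : e < 1.
  case: s us sn far {sC AB f_inj BE fe ufs} => [|p [|q s]] us sn far.
  - by rewrite -sn in n1.
  - by rewrite -sn in n1.
  have npq : p != q by move: us; rewrite /= inE negb_or => /andP[/andP[]].
  have := far p q; rewrite !inE !eqxx orbT => /(_ isT isT npq).
  by have := flat_dist_le1 p q; lra.
(* Being matched with [s], [B] has exactly [n] points, which excludes the identity clause. *)
have {}BC' : merged (map f s) C'.
  case: BC' => [[B1 _]|[t [ut _ tE tC']]].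
    have := finite_subset_space_size B1 ufs; rewrite BE size_map sn.
    by move=> /(_ (fun _ => id)); case: (n) n1 => // m _; rewrite /= ltnn.
  apply: merged_perm tC'; apply: uniq_perm => // p.
  have [h h'] : [set` t] p <-> [set` map f s] p by rewrite -tE BE.
  by apply/idP/idP; [exact: h|exact: h'].
rewrite -sn; apply: merged_close BC' => // p sp.
exact: flat_dist_near (fe p sp).
Qed.

(** If either set is separated, matching applies. Otherwise the path from [C] through [A] and [B] to
    [C'] costs [2 * n * e + e + 2 * n * e]. *)
Lemma merge_graph_lipschitz n e A B C C' : (1 < n)%N -> 0 <= e ->
  finite_subset_space X n A -> finite_subset_space X n B ->
  near_subset e A B -> near_subset e B A ->
  merge_graph n A C -> merge_graph n B C' ->
  near_subset ((4 * n%:R + 1) * e) C C' /\ near_subset ((4 * n%:R + 1) * e) C' C.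
Proof.
move=> n1 e0 An Bn AB BA AC BC'.
have ne0 : 0 <= n%:R * (2 * e) by rewrite !mulr_ge0.
have KE : (4 * n%:R + 1) * e = n%:R * (2 * e) + e + n%:R * (2 * e) by ring.
have Ke : e + n%:R * (2 * e) <= (4 * n%:R + 1) * e by rewrite KE; lra.
have [[nAC nCA]|sepA] := merge_graph_dichotomy e0 AC; last first.
  have [? ?] := separated_merge_close n1 e0 Bn AB sepA BC'.
  by split; apply: near_subsetW Ke _.
have [[nBC nCB]|sepB] := merge_graph_dichotomy e0 BC'; last first.
  have [? ?] := separated_merge_close n1 e0 An BA sepB AC.
  by split; apply: near_subsetW Ke _.
rewrite KE; split.
  exact: near_subset_trans (near_subset_trans nCA AB) nBC.
exact: near_subset_trans (near_subset_trans nCB BA) nAC.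
Qed.

Lemma LCP_flat_sheets : LCP X.
Proof.
move=> n n2.
have [r rP] : {r : set X -> set X & forall A,
    finite_subset_space X n A -> merge_graph n A (r A)}.
  apply: (@choice _ _ (fun A C => finite_subset_space X n A -> merge_graph n A C)).
  move=> A; have [An|nAn] := pselect (finite_subset_space X n A); last first.
    by exists A => /nAn.
  have [s [AE us s0 sn]] := finite_subset_space_seq An.
  move: sn; rewrite leq_eqVlt => /orP[/eqP sn|sn].
    by have [C sC] := merged_exists s; exists C => _; right; exists s.
  exists A => _; left; split=> //; rewrite AE; apply: seq_finite_subset_space => //.
  by case: (n) n2 sn.
have r_fun : set_fun (finite_subset_space X n) (finite_subset_space X n.-1) r.
  move=> A An; case: (rP A An) => [[A1 ->//]|[s [us sn _ sC]]].
  by rewrite -sn; apply: merged_subset_space; rewrite ?sn.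
have sub A : finite_subset_space X n.-1 A -> finite_subset_space X n A.
  case=> A0 An; split=> //; apply: card_le_trans An _.
  by rewrite card_le_II leq_pred.
exists r; split=> //.
  exists (4 * n%:R + 1) => A B An Bn.
  have [AB BA] := (hausdorff_dist_le _ An Bn).1 (lexx _).
  apply/(hausdorff_dist_le _ (r_fun _ An) (r_fun _ Bn)).
  apply: (merge_graph_lipschitz n2 _ An Bn AB BA (rP A An) (rP B Bn)).
  exact: hausdorff_dist_ge0 An Bn.
(* A set in X(n-1) cannot have [n] distinct points, so only the identity clause remains. *)
move=> A A1; case: (rP A (sub A A1)) => [[]//|[s [us sn AE _]]].
have := finite_subset_space_size A1 us; rewrite AE sn => /(_ (fun _ => id)).
by case: (n) n2 => // m _; rewrite /= ltnn.
Qed.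

End FlatLCP.

Theorem mainTheorem5 (R : realType) :
  exists (X Y : metricType R) (f : X -> Y),
    quasisymmetric f /\ LCP X /\ ~ LCP Y.
Proof.
exists (sheets R false), (sheets R true), id; split.
  exact: quasisymmetric_snowflake.
by split; [exact: LCP_flat_sheets|exact: not_LCP_snowflake].
Qed.
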